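(* Let $k$ be a subfield of $\mathbf{C}$, let $A$ be a totally ordered locally finite graded set with an operation $[\cdot,\cdot]$ on $\bar A=A\cup\{0\}$ satisfying (S0)–(S3), and let $*$ be the associated quasi-shuffle product on $\mathfrak{A}=k\langle A\rangle$. Then $(\mathfrak{A},* )$ is the free (commutative) polynomial $k$-algebra on the Lyndon words.
   Context: $A$ is a graded set, $A=\bigsqcup_{n\ge1}A_n$ with each $A_n$ (the elements of degree $n$) finite; elements of $A$ are called letters and $|a|$ is the degree of a letter $a$. $\mathfrak{A}=k\langle A\rangle$ is the $k$-vector space of noncommutative polynomials in the letters, with basis the words (monomials) in the letters, including the empty word $1$. Juxtaposition denotes concatenation. Let $\bar A=A\cup\{0\}$ and let $[\cdot,\cdot]:\bar A\times\bar A\to\bar A$ be a function satisfying: (S0) $[a,0]=0$ for all $a\in\bar A$; (S1) $[a,b]=[b,a]$ for all $a,b\in\bar A$; (S2) $[[a,b],c]=[a,[b,c]]$ for all $a,b,c\in\bar A$; (S3) for all $a,b\in A$, either $[a,b]=0$ or $|[a,b]|=|a|+|b|$. The quasi-shuffle product $*$ is the $k$-bilinear operation on $\mathfrak{A}$ defined recursively on words by $1*w=w*1=w$ and $aw_1*bw_2=a(w_1*bw_2)+b(aw_1*w_2)+[a,b](w_1*w_2)$ for letters $a,b$ and words $w_1,w_2$. The total order on $A$ is extended to a total order on words lexicographically: $u<uv$ for every nonempty word $v$, and $w_1aw_2<w_1bw_3$ for letters $a<b$ and words $w_1,w_2,w_3$. A word $w\ne1$ is Lyndon if $w<v$ for every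 factorization $w=uv$ (concatenation) with $u,v$ nonempty. *)

(* Defs.v *)
From mathcomp Require Import all_boot all_order all_algebra.
From mathcomp Require Import reals.
From mathcomp Require Export finmap monalg complex.

Set Implicit Arguments.
Unset Strict Implicit.
Unset Printing Implicit Defensive.

Import Order.TTheory GRing.Theory Num.Theory.

Local Open Scope ring_scope.

Definition locally_finite_grading (A : choiceType) (deg : A -> nat) : Prop :=
  (forall a, (0 < deg a)%N) /\
  (forall n, exists s : seq A, forall a, deg a = n -> a \in s).

(* A with a zero adjoined is [option A], [None] being the zero. *)
Record qs_bracket (A : choiceType) (deg : A -> nat)
    (br : option A -> option A -> option A) : Prop := QsBracket {
  qs_S0 : forall a : option A, br a None = None;
  qs_S1 : forall a b : option A, br a b = br b a;
  qs_S2 : forall a b c : option A, br (br a b) c = br a (br b c);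
  qs_S3 : forall a b : A, br (Some a) (Some b) = None \/
    exists2 c, br (Some a) (Some b) = Some c & deg c = (deg a + deg b)%N
}.

Section QuasiShuffle.
Context (k : fieldType) (A : choiceType).
Variable br : option A -> option A -> option A.

(* Words in the letters A are the elements of the free monoid {fmonom A}, and
   k<A> is the monoid algebra {malg k[{fmonom A}]}; its ring product is
   concatenation. *)
Local Notation kA := {malg k[{fmonom A}]}.

Definition word_of (s : seq A) : {fmonom A} := FMonom s.

(* The zero of [option A] becomes the zero polynomial. *)
Definition letter (a : option A) : kA :=
  if a is Some a' then << fmu a' >> else 0.

Fixpoint qsh_word (s : seq A) : seq A -> kA :=
  fix qsh_s (t : seq A) : kA :=
    match s, t with
    | [::], _ => << word_of t >>
    | _, [::] => << word_of s >>
    | a :: s', b :: t' =>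
        letter (Some a) * qsh_word s' t + letter (Some b) * qsh_s t'
        + letter (br (Some a) (Some b)) * qsh_word s' t'
    end.

Definition qshuffle (p q : kA) : kA :=
  \sum_(u <- msupp p) \sum_(v <- msupp q) (p@_u * q@_v) *: qsh_word u v.

Lemma msuppU1 (u : {fmonom A}) : msupp (<< u >> : kA) = [fset u]%fset.
Proof. by rewrite msuppU oner_eq0. Qed.

Lemma qshuffle_words (u v : {fmonom A}) :
  qshuffle << u >> << v >> = qsh_word u v.
Proof.
by rewrite /qshuffle !msuppU1 !big_seq_fset1 !mcoeffUU mulr1 scale1r.
Qed.

Lemma qshuffle1w (w : {fmonom A}) : qshuffle 1 << w >> = << w >>.
Proof. by rewrite qshuffle_words fm1; case: w => -[]. Qed.

Lemma qshufflew1 (w : {fmonom A}) : qshuffle << w >> 1 = << w >>.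
Proof. by rewrite qshuffle_words fm1; case: w => -[]. Qed.

Lemma qshuffle_cons (a b : A) (w1 w2 : {fmonom A}) :
  qshuffle << mmul (fmu a) w1 >> << mmul (fmu b) w2 >> =
    << fmu a >> * qshuffle << w1 >> << mmul (fmu b) w2 >>
    + << fmu b >> * qshuffle << mmul (fmu a) w1 >> << w2 >>
    + letter (br (Some a) (Some b)) * qshuffle << w1 >> << w2 >>.
Proof. by rewrite !qshuffle_words !fmM !fmU. Qed.

End QuasiShuffle.

Section Lyndon.
Context (d : Order.disp_t) (A : orderType d).

Definition word_lt (u v : {fmonom A}) : bool :=
  ((u : seqlexi A) < (v : seqlexi A))%O.

Definition lyndon (w : {fmonom A}) : bool :=
  (w != mone) &&
  all (fun i => word_lt w (word_of (drop i w))) (iota 1 (size w).-1).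

Lemma lyndonP (w : {fmonom A}) :
  reflect (w <> mone /\ forall u v : {fmonom A},
             u <> mone -> v <> mone -> w = mmul u v -> word_lt w v)
          (lyndon w).
Proof.
have neq1 (x : {fmonom A}) : (x <> mone) <-> (0 < size x)%N.
  split=> [/eqP|x0 xE]; last by rewrite xE fm1 in x0.
  by rewrite fmP fm1 -size_eq0 lt0n.
apply: (iffP andP) => [[/eqP w1 /allP lw]|[w1 lw]]; split=> //.
- move=> u v /neq1 u0 /neq1 v0 wE.
  have wuv : w = u ++ v :> seq A by rewrite wE fmM.
  have := lw (size u); rewrite mem_iota wuv size_cat drop_size_cat //.
  rewrite /word_of fmK; apply; rewrite u0 /= add1n prednK ?addn_gt0 ?u0 //.
  by rewrite -[X in (X < _)%N]addn0 ltn_add2l.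
- exact/eqP.
- apply/allP => i; rewrite mem_iota => /andP[i0 iw].
  have {}iw : (i < size w)%N.
    by move: iw; rewrite add1n prednK //; exact/neq1.
  apply: (lw (word_of (take i w))).
  + by apply/neq1; rewrite /= size_take iw.
  + by apply/neq1; rewrite /= size_drop subn_gt0.
  + by apply/val_inj; rewrite /= fmM /= cat_take_drop.
Qed.

Lemma word_lt_prefix (u v : {fmonom A}) : v <> mone -> word_lt u (mmul u v).
Proof.
move=> v1; rewrite /word_lt fmM.
elim: (u : seq A) => [|a s IH] /=; last by rewrite ltxi_cons lexx.
by rewrite ltxi0s -fm1 -fmP; apply/eqP.
Qed.

Lemma word_lt_letter (a b : A) (w1 w2 w3 : {fmonom A}) : (a < b)%O ->
  word_lt (mmul (mmul w1 (fmu a)) w2) (mmul (mmul w1 (fmu b)) w3).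
Proof.
move=> ab; rewrite /word_lt !fmM !fmU -!catA.
elim: (w1 : seq A) => [|c s IH] /=; last by rewrite ltxi_cons lexx.
by rewrite ltxi_cons (ltW ab) leNgt ab.
Qed.

End Lyndon.

Definition comm_algebra (k : fieldType) (V : lmodType k)
    (mul : V -> V -> V) (one : V) : Prop :=
  [/\ associative mul, commutative mul, left_id one mul
    & forall p, linear (mul p)].

(* {malg k[{cmonom X}]} is the polynomial algebra k[X] in the (possibly
   infinitely many) variables << ucm x >>, x in X. *)
Definition polynomial_algebra_on (k : fieldType) (V : lmodType k)
    (mul : V -> V -> V) (one : V) (X : choiceType) (gen : X -> V) : Prop :=
  comm_algebra mul one /\
  exists phi : {linear {malg k[{cmonom X}]} -> V},
    [/\ bijective phi, phi 1 = one,
        forall p q, phi (p * q) = mul (phi p) (phi q)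
      & forall x, phi << ucm x >> = gen x].

(* Main.v *)
From HB Require Import structures.
Require Import Defs.
From mathcomp Require Import all_boot all_order all_algebra.
From mathcomp Require Import reals.

Import Order.TTheory GRing.Theory Num.Theory.
Local Open Scope ring_scope.

Set Implicit Arguments.
Unset Strict Implicit.
Unset Printing Implicit Defensive.

(* Every word w is uniquely a product x_1 ... x_n of a nonincreasing list of
   Lyndon words. Among the words of maximal length occurring in the
   quasi-shuffle product x_1 * ... * x_n, which are the plain shuffles of the
   x_i, the lexicographically largest is w itself, and its coefficient is a
   positive integer. So the quasi-shuffle monomials in the Lyndon words are
   related to the basis of words by a triangular system with nonzero diagonal
   (words being compared first by length, then lexicographically among the
   permutations of a word), which is invertible in characteristic 0.

   The shuffle bound is proved for the shuffles of two arbitrary words with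
   factorizations X and Y, the bound being the product of the sorted list
   X ++ Y, by induction on the first letter of the shuffle. *)

(** * Shuffles and quasi-shuffles as lists of words *)

Section Shuffles.
Context {A : eqType}.
Implicit Types (u v z s : seq A) (X : seq (seq A)).

Inductive shuffle_of : seq A -> seq A -> seq A -> Prop :=
| ShuffleNil : shuffle_of [::] [::] [::]
| ShuffleLeft a u v z : shuffle_of u v z -> shuffle_of (a :: u) v (a :: z)
| ShuffleRight a u v z : shuffle_of u v z -> shuffle_of u (a :: v) (a :: z).

Lemma shuffle_of_cat u v : shuffle_of u v (u ++ v).
Proof.
elim: u => [|a u IH] /=; last exact: ShuffleLeft.
by elim: v => [|b v IH]; [apply: ShuffleNil | apply: ShuffleRight].
Qed.

Lemma shuffle_of_perm u v z : shuffle_of u v z -> perm_eq z (u ++ v).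
Proof.
elim=> {u v z} [//|a u v z _ IH|a u v z _ IH]; first by rewrite /= perm_cons.
by rewrite perm_sym perm_catC /= perm_cons perm_catC perm_sym.
Qed.

Context (br : option A -> option A -> option A).

(** Keeping the words of a quasi-shuffle in a list with repetitions makes every coefficient a count,
    independent of the field. *)
Fixpoint qsh_words s : seq A -> seq (seq A) :=
  fix qsh_words_s t : seq (seq A) :=
    match s, t with
    | [::], _ => [:: t]
    | _, [::] => [:: s]
    | a :: s', b :: t' =>
        map (cons a) (qsh_words s' t) ++ map (cons b) (qsh_words_s t')
        ++ (if br (Some a) (Some b) is Some c
            then map (cons c) (qsh_words s' t') else [::])
    end.

(** Each use of the bracket merges two letters into one, so a word of full length arises without
    brackets. *)
Lemma qsh_words_size_shuffle u v z : z \in qsh_words u v ->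
  (size z < size u + size v)%N \/ shuffle_of u v z.
Proof.
elim: u v z => [|a u IHu] v z.
  have -> : qsh_words [::] v = [:: v] by case: v.
  by rewrite inE => /eqP->; right; apply: shuffle_of_cat.
elim: v z => [|b v IHv] z.
  by rewrite inE => /eqP->; right; have := shuffle_of_cat (a :: u) [::]; rewrite cats0.
rewrite /= !mem_cat => /or3P[/mapP[y yP ->]|/mapP[y yP ->]|].
- by case: (IHu _ _ yP) => h; [left | right; apply: ShuffleLeft].
- case: (IHv _ yP) => h; [left | right; exact: ShuffleRight].
  by rewrite addnS ltnS.
case: (br _ _) => // c /mapP[y yP ->]; left; rewrite /= addSn addnS !ltnS.
by case: (IHu _ _ yP) => [/ltnW //|/shuffle_of_perm/perm_size->]; rewrite size_cat.
Qed.

Lemma cat_in_qsh_words u v : u ++ v \in qsh_words u v.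
Proof.
elim: u v => [|a u IH] [|b v] //=; rewrite ?inE ?cats0 //.
by rewrite mem_cat (map_f (cons a) (IH (b :: v))).
Qed.

Definition qsh_prod_words X : seq (seq A) :=
  foldr (fun x zs => flatten [seq qsh_words x z | z <- zs]) [:: [::]] X.

(** All letters of a factor are taken before those of the later factors. This occurrence makes the
    diagonal coefficient positive. *)
Lemma flatten_in_qsh_prod_words X : flatten X \in qsh_prod_words X.
Proof.
elim: X => [|x X IH]; first by rewrite inE.
by apply/flatten_mapP; exists (flatten X) => //; apply: cat_in_qsh_words.
Qed.

End Shuffles.

(** * Lexicographic order and the Lyndon factorization *)

Section LyndonWords.
Context {d : Order.disp_t} {A : orderType d}.
Implicit Types (u v w x y z p q r s t : seq A) (X Y : seq (seq A)).

Local Notation "x <=l y" := (@Order.le _ (seqlexi A) x y) (at level 70).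
Local Notation "x <l y" := (@Order.lt _ (seqlexi A) x y) (at level 70).

Definition word_ge : rel (seq A) := fun x y => y <=l x.

Lemma word_ge_trans : transitive word_ge.
Proof. by move=> y x z xy yz; apply: le_trans yz xy. Qed.

Lemma word_ge_anti : antisymmetric word_ge.
Proof. by move=> x y /andP[yx xy]; apply: (@le_anti _ (seqlexi A)); apply/andP. Qed.

Lemma word_ge_total : total word_ge.
Proof. by move=> x y; apply: le_total. Qed.

Lemma lexi_cat2l p u v : (p ++ u <=l p ++ v) = (u <=l v).
Proof. by elim: p => //= a p IH; rewrite lexi_cons lexx. Qed.

Lemma ltxi_cat2l p u v : (p ++ u <l p ++ v) = (u <l v).
Proof. by elim: p => //= a p IH; rewrite ltxi_cons lexx. Qed.

Lemma lexi_catr p q : p <=l p ++ q.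
Proof. by elim: p => //= a p IH; rewrite lexi_cons lexx. Qed.

Lemma ltxi_catr p q : q != [::] -> p <l p ++ q.
Proof. by case: q => // b q _; elim: p => //= a p IH; rewrite ltxi_cons lexx. Qed.

Lemma cat_eq_cat_le x r y s : (size x <= size y)%N -> x ++ r = y ++ s ->
  exists2 t, y = x ++ t & r = t ++ s.
Proof.
elim: x y => [|a x IH] [|b y] //=; first by move=> _ ->; exists [::].
  by move=> _ ->; exists (b :: y).
by move=> xy [-> /(IH y xy)[t -> ->]]; exists t.
Qed.

(** Unless [x] is a prefix of [y], the two words differ at a position inside both, and whatever is
    appended afterwards does not affect the comparison. *)
Lemma lexi_prefixVlt x y : x <=l y ->
  (exists r, y = x ++ r) \/ (forall r s, x ++ r <l y ++ s).
Proof.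
elim: x y => [|a x IH] [|b y]; first by left; exists [::].
- by left; exists (b :: y).
- by [].
rewrite lexi_cons => /andP[ab /implyP h].
have [ba|ba] := boolP (b <= a)%O.
  have -> : a = b by apply/le_anti; rewrite ab ba.
  case: (IH _ (h ba)) => [[r ->]|lt]; first by left; exists r.
  by right=> r s; rewrite !cat_cons ltxi_cons lexx /=; apply: lt.
by right=> r s; rewrite !cat_cons ltxi_cons ab (negbTE ba).
Qed.

Lemma ltxi_cat_le_size x y r s :
  (size y <= size x)%N -> x <l y -> x ++ r <l y ++ s.
Proof.
move=> syx xy; case: (lexi_prefixVlt (ltW xy)) => // -[t yE].
have t0 : t = [::].
  apply/size0nil; move: syx; rewrite yE size_cat.
  by case: (size t) => // n; rewrite addnS ltnNge leq_addr.
by move: xy; rewrite yE t0 cats0 ltxx.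
Qed.

Definition lyndon_word w : Prop :=
  w != [::] /\ forall u v, u != [::] -> v != [::] -> w = u ++ v -> w <l v.

Lemma lyndon_letter (a : A) : lyndon_word [:: a].
Proof. by split=> // -[|b [|c u]] [|e v]. Qed.

(** A proper suffix of [u ++ v] either lies in [v], hence is at least [v], or is [r ++ v] with [r] a
    proper suffix of [u]. In the second case [r] is no longer than [u], so [u <l r] survives
    appending. *)
Lemma lyndon_cat u v :
  lyndon_word u -> lyndon_word v -> u <l v -> lyndon_word (u ++ v).
Proof.
move=> [u0 lu] [v0 lv] uv.
(* If [v = u ++ r], cancelling [u] leaves [v <l r], which holds since [v] is Lyndon; otherwise [u]
   and [v] already differ at a letter. *)
have uvv : u ++ v <l v.
  case: (lexi_prefixVlt (ltW uv)) => [[r vE]|lt]; last by rewrite -[v in X in _ <l X]cats0.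
  have r0 : r != [::] by apply: contraTneq uv => r0; rewrite vE r0 cats0 ltxx.
  by rewrite {2}vE ltxi_cat2l; apply: lv vE.
split; first by case: (u) u0.
move=> s t s0 t0 stE.
have [le|lt] := leqP (size u) (size s).
  have [r sE vE] := cat_eq_cat_le le stE.
  have [r0|r0] := eqVneq r [::]; first by move: uvv; rewrite {2}vE r0.
  by apply: (lt_trans uvv); apply: lv vE.
have [r uE tE] := cat_eq_cat_le (ltnW lt) (esym stE).
have r0 : r != [::].
  by apply: contraTneq lt => r0; rewrite uE r0 cats0 ltnn.
rewrite tE; apply: ltxi_cat_le_size; last exact: lu uE.
by rewrite uE size_cat leq_addl.
Qed.

Definition lyndon_decr X : Prop :=
  sorted word_ge X /\ forall x, x \in X -> lyndon_word x.

Lemma lyndon_decr_cons x X : lyndon_decr (x :: X) ->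
  [/\ lyndon_word x, lyndon_decr X & forall y, y \in X -> y <=l x].
Proof.
move=> [/= sX lX]; split.
- exact/lX/mem_head.
- by split=> [|y yX]; [apply: path_sorted sX | apply: lX; rewrite inE yX orbT].
- by move: sX; rewrite path_sortedE; [case/andP => /allP | exact: word_ge_trans].
Qed.

(** Letters are prepended one at a time. The new head is merged with the following factor for as
    long as it is smaller than that factor, and [lyndon_cat] keeps it Lyndon. *)
Lemma lyndon_factor w : exists2 X, lyndon_decr X & flatten X = w.
Proof.
elim: w => [|a w [X dX <-]]; first by exists [::].
rewrite -[a :: _]/([:: a] ++ flatten X).
elim: X [:: a] (lyndon_letter a) dX => [|x X IH] u lu.
  by exists [:: u]; split=> // x; rewrite inE => /eqP->.
move=> /[dup] dxX /lyndon_decr_cons[lx dX xX].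
have [xu|ux] := leP (x : seqlexi A) u.
  exists (u :: x :: X) => //; split=> [|y].
    by rewrite /= /word_ge xu; case: dxX.
  by rewrite inE => /orP[/eqP->|] //; case: dxX => _; apply.
have [Z dZ ZE] := IH _ (lyndon_cat lu lx ux) dX.
by exists Z => //; rewrite ZE /= catA.
Qed.

(** The end of [r] falls within some factor [y], possibly at its end; [t] is the part of [y] read up
    to there. *)
Lemma prefix_flatten_suffix r s Y : r != [::] -> flatten Y = r ++ s ->
  exists r' t y e, [/\ r = r' ++ t, t != [::], y \in Y & y = t ++ e].
Proof.
elim: Y r => [|y Y IH] r r0 /= E; first by case: r r0 E.
have [le|lt] := leqP (size r) (size y).
  have [e yE _] := cat_eq_cat_le le (esym E).
  by exists [::], r, y, e; split=> //; apply: mem_head.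
have [e rE E'] := cat_eq_cat_le (ltnW lt) E.
have e0 : e != [::] by apply: contraTneq lt => e0; rewrite rE e0 cats0 ltnn.
have [r' [t [z [e' [E1 t0 zY zE]]]]] := IH _ e0 E'.
by exists (y ++ r'), t, z, e'; rewrite -catA -E1 inE zY orbT.
Qed.

(* If one first factor is longer than the other, its excess ends with a
   suffix that is a prefix of a later, hence smaller, factor. *)
Lemma lyndon_decr_inj X Y :
  lyndon_decr X -> lyndon_decr Y -> flatten X = flatten Y -> X = Y.
Proof.
have absurd x y X' Y' : (size y < size x)%N ->
    lyndon_decr (x :: X') -> lyndon_decr (y :: Y') ->
    flatten (x :: X') = flatten (y :: Y') -> False.
  move=> lt /lyndon_decr_cons[lx _ _] /lyndon_decr_cons[[y0 ly] _ Yy] /= E.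
  have [r xE E'] := cat_eq_cat_le (ltnW lt) (esym E).
  have r0 : r != [::] by apply: contraTneq lt => r0; rewrite xE r0 cats0 ltnn.
  have [r' [t [z [e [rE t0 zY zE]]]]] := prefix_flatten_suffix r0 E'.
  have xt : x <l t.
    by case: lx => _ /(_ (y ++ r') t); apply => //; [case: (y) y0 | rewrite -catA -rE].
  suff : x <l x by rewrite ltxx.
  apply: (lt_le_trans xt); apply: (@le_trans _ _ (z : seqlexi A)); first by rewrite zE lexi_catr.
  by apply: (le_trans (Yy z zY)); rewrite xE lexi_catr.
elim: X Y => [|x X IH] [|y Y] //.
- by move=> _ /lyndon_decr_cons[[y0 _] _ _] /=; case: (y) y0.
- by move=> /lyndon_decr_cons[[x0 _] _ _] /=; case: (x) x0.
move=> dX dY E.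
have [xy|yx|sxy] := ltngtP (size x) (size y).
- by case: (absurd _ _ _ _ xy dY dX (esym E)).
- by case: (absurd _ _ _ _ yx dX dY E).
move/eqP: E; rewrite /= eqseq_cat // => /andP[/eqP-> /eqP E].
by congr cons; apply: IH => //; [case/lyndon_decr_cons: dX | case/lyndon_decr_cons: dY].
Qed.

(** * Sorting factors, and the lexicographic bound on shuffles *)

Local Notation wsort := (sort word_ge).

Lemma wsort_sorted X : sorted word_ge (wsort X).
Proof. exact/sort_sorted/word_ge_total. Qed.

Lemma perm_wsort X Y : perm_eq X Y -> wsort X = wsort Y.
Proof.
by move/perm_sortP; apply; [apply: word_ge_total|apply: word_ge_trans|apply: word_ge_anti].
Qed.

Lemma wsort_cat X Y : (forall x y, x \in X -> y \in Y -> y <=l x) ->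
  wsort (X ++ Y) = wsort X ++ wsort Y.
Proof.
move=> XY; apply: (sorted_eq word_ge_trans word_ge_anti).
- exact: wsort_sorted.
- rewrite (sorted_pairwise word_ge_trans) pairwise_cat.
  rewrite -!(sorted_pairwise word_ge_trans) !wsort_sorted !andbT.
  by apply/allrelP => x y; rewrite !mem_sort; apply: XY.
by rewrite perm_sort perm_cat // perm_sym perm_sort.
Qed.

Lemma wsort_id X : sorted word_ge X -> wsort X = X.
Proof. exact/sorted_sort/word_ge_trans. Qed.

Lemma sorted_filter_split y X : sorted word_ge X ->
  X = [seq x <- X | word_ge x y] ++ [seq x <- X | ~~ word_ge x y].
Proof.
move=> sX; apply: (sorted_eq word_ge_trans word_ge_anti) => //.
- rewrite (sorted_pairwise word_ge_trans) pairwise_cat.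
  rewrite -!(sorted_pairwise word_ge_trans) !(sorted_filter word_ge_trans) // !andbT.
  apply/allrelP => u v; rewrite !mem_filter => /andP[yu _] /andP[vy _].
  apply: (word_ge_trans yu); have := word_ge_total y v.
  by rewrite (negbTE vy) orbF.
by rewrite perm_sym perm_filterC.
Qed.

Lemma lexi_catl_size x y r : size x = size y -> x <=l y -> x ++ r <=l y ++ r.
Proof.
move=> sxy; rewrite le_eqVlt => /orP[/eqP->|xy]; first exact: lexx.
by apply/ltW/ltxi_cat_le_size; rewrite ?sxy.
Qed.

Lemma lyndon_decr_flatten0 X : lyndon_decr X -> flatten X = [::] -> X = [::].
Proof.
by case: X => // x X /lyndon_decr_cons[[x0 _] _ _] /=; case: (x) x0.
Qed.

Lemma flatten_size_perm X Y : perm_eq X Y -> size (flatten X) = size (flatten Y).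
Proof. by move=> XY; rewrite !size_flatten; apply/perm_sumn/perm_map. Qed.

(* When a letter is split off a Lyndon word [l = a :: s], the next [y] of [Y]
   enters behind a prefix [p] of [l]; since [y] is Lyndon and [y >= l >= p],
   [p ++ y] is no larger than [y] followed by anything. *)
Lemma lexi_cons_flatten_wsort (a : A) s X Y :
    lyndon_decr X -> flatten X = s ->
    lyndon_decr Y -> (forall y, y \in Y -> a :: s <=l y) ->
  a :: flatten (wsort (X ++ Y)) <=l flatten Y ++ (a :: s).
Proof.
move=> dX sE; have sX := proj1 dX.
case: Y => [_ _|y Y dyY Yl]; first by rewrite cats0 wsort_id // sE.
have [[y0 ly] dY yY] := lyndon_decr_cons dyY.
pose X1 := [seq x <- X | word_ge x y]; pose X2 := [seq x <- X | ~~ word_ge x y].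
have XE : X = X1 ++ X2 by apply: sorted_filter_split.
have dX2 : lyndon_decr X2.
  split; first exact: (sorted_filter word_ge_trans).
  by move=> x; rewrite mem_filter => /andP[_]; case: dX => _; apply.
have -> : wsort (X ++ y :: Y) = X1 ++ y :: wsort (X2 ++ Y).
  have -> : wsort (X ++ y :: Y) = wsort (rcons X1 y ++ (X2 ++ Y)).
    apply: perm_wsort; rewrite {1}XE -cats1 -!catA perm_cat2l.
    by rewrite perm_catC /= perm_cons perm_catC.
  rewrite wsort_cat => [|u v].
    rewrite (@wsort_id (rcons X1 y)) ?cat_rcons //.
    rewrite (sorted_pairwise word_ge_trans) pairwise_rcons.
    rewrite -(sorted_pairwise word_ge_trans) (sorted_filter word_ge_trans) //.
    by rewrite andbT; apply/allP => u; rewrite mem_filter => /andP[].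
  rewrite mem_rcons inE mem_cat !mem_filter => uP vP.
  have vy : v <=l y.
    case/orP: vP => [/andP[vy _]|]; last exact: yY.
    by have := word_ge_total y v; rewrite (negbTE vy) orbF.
  case/orP: uP => [/eqP->//|/andP[yu _]]; exact: le_trans vy yu.
rewrite flatten_cat /= -catA.
have lE : a :: s = (a :: flatten X1) ++ flatten X2.
  by rewrite -sE XE /= flatten_cat.
have ly' : a :: s <=l y by apply: Yl; apply: mem_head.
set p := a :: flatten X1 in lE *.
rewrite -cat_cons -/p.
have py : p <=l y by apply: le_trans ly'; rewrite lE lexi_catr.
case: (lexi_prefixVlt py) => [[r yE]|lt]; last exact/ltW/lt.
(* If [y] properly extends [p], cancelling [p] leaves [y] against its suffix [r], which is larger
   because [y] is Lyndon. *)
have [r0|r0] := eqVneq r [::]; last first.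
  rewrite [X in _ <=l X ++ _]yE -catA lexi_cat2l.
  apply/ltW/ltxi_cat_le_size; first by rewrite yE size_cat leq_addl.
  by apply: (ly p).
(* Now [y = p] is a prefix of [a :: s], and [a :: s <=l y] forces equality. The remaining words of
   [Y] are squeezed between the two, so both sides are powers of [y]. *)
rewrite r0 cats0 in yE; rewrite -yE lexi_cat2l.
have X20 : X2 = [::].
  apply: lyndon_decr_flatten0 => //; apply/eqP; move: ly'; rewrite lE yE.
  by apply: contraTT => q0; rewrite -ltNge ltxi_catr.
rewrite X20 cats0 -yE in lE; rewrite X20 lE wsort_id; last by case: dY.
have /all_pred1P -> : all (pred1 y) Y.
  apply/allP => z zY /=; apply/eqP/(@le_anti _ (seqlexi A)).
  by rewrite yY // -lE Yl // inE zY orbT.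
suff -> : y ++ flatten (nseq (size Y) y) = flatten (nseq (size Y) y) ++ y by [].
by elim: (size Y) => [|n IH]; rewrite /= ?cats0 // -catA -IH.
Qed.

(** The last factor is a proper suffix of the Lyndon word, hence larger than it, and the other
    factors are at least the last one. *)
Lemma lyndon_suffix_factor_gt (a : A) s X x :
  lyndon_word (a :: s) -> lyndon_decr X -> flatten X = s -> x \in X ->
  a :: s <l x.
Proof.
move=> [_ ls] [sX lX] XE xX.
case/lastP: X sX lX XE xX => // X t sX lX XE xX.
have t0 : t != [::] by case: (lX t); rewrite ?mem_rcons ?mem_head.
have lt : a :: s <l t.
  by apply: (ls (a :: flatten X)) => //; rewrite -XE flatten_rcons.
move: xX; rewrite mem_rcons inE => /orP[/eqP->//|xX].
apply: (lt_le_trans lt); move: sX.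
rewrite (sorted_pairwise word_ge_trans) pairwise_rcons => /andP[/allP/(_ x xX)].
by [].
Qed.

(** The factors in [X] and those of [Y] below [l] form a common tail of both sorted lists, so only
    the part [Y1] of [Y] that is at least [l] interacts with the splitting of [l]. *)
Lemma lexi_cons_flatten_wsort_factor (a : A) s Z X Y :
    lyndon_decr ((a :: s) :: X) -> lyndon_decr Y ->
    lyndon_decr Z -> flatten Z = s ->
  a :: flatten (wsort ((Z ++ X) ++ Y)) <=l flatten (wsort (((a :: s) :: X) ++ Y)).
Proof.
move=> dlX dY dZ ZE; set l := a :: s.
have [ll dX lX] := lyndon_decr_cons dlX.
pose Y1 := [seq y <- Y | word_ge y l]; pose Y2 := [seq y <- Y | ~~ word_ge y l].
have YE : Y = Y1 ++ Y2 by apply: sorted_filter_split; case: dY.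
have sY1 : sorted word_ge Y1 by apply: (sorted_filter word_ge_trans); case: dY.
have dY1 : lyndon_decr Y1.
  by split=> // y; rewrite mem_filter => /andP[_]; case: dY => _; apply.
have Y1l y : y \in Y1 -> l <=l y by rewrite mem_filter => /andP[].
have XY2 v : v \in X ++ Y2 -> v <=l l.
  rewrite mem_cat mem_filter => /orP[/lX//|/andP[vl _]].
  by have := word_ge_total l v; rewrite (negbTE vl) orbF.
have -> : wsort ((Z ++ X) ++ Y) = wsort (Z ++ Y1) ++ wsort (X ++ Y2).
  rewrite -wsort_cat => [|x y xZ yX].
    apply: perm_wsort; rewrite {1}YE -!catA perm_cat2l perm_sym.
    by rewrite perm_catCA.
  apply: (le_trans (XY2 y yX)).
  move: xZ; rewrite mem_cat => /orP[xZ|/Y1l//].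
  exact/ltW/(lyndon_suffix_factor_gt ll dZ).
have -> : wsort ((l :: X) ++ Y) = (rcons Y1 l) ++ wsort (X ++ Y2).
  rewrite -(@wsort_id (rcons Y1 l)) -?wsort_cat => [|x y|].
  - apply: perm_wsort; rewrite {1}YE -cats1 -!catA /= perm_sym.
    by rewrite perm_catC /= perm_cons -catA perm_cat2l perm_catC.
  - rewrite mem_rcons inE => xP /XY2 yl; apply: (le_trans yl).
    by case/orP: xP => [/eqP->//|/Y1l].
  rewrite (sorted_pairwise word_ge_trans) pairwise_rcons.
  by rewrite -(sorted_pairwise word_ge_trans) sY1 andbT; apply/allP => y /Y1l.
(* The heads have equal length, so appending the common tail preserves the comparison. *)
rewrite !flatten_cat flatten_rcons -cat_cons; apply: lexi_catl_size.
  rewrite /= (flatten_size_perm (permEl (perm_sort _ _))) flatten_cat !size_cat.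
  by rewrite ZE addnC -addnS.
exact: lexi_cons_flatten_wsort.
Qed.

(** The shuffle pattern of [z] is kept until [v] and [v'] first differ; after that larger letter any
    completion will do. *)
Lemma shuffle_of_le u v z v' : shuffle_of u v z -> size v' = size v ->
  v <=l v' -> exists2 z', shuffle_of u v' z' & z <=l z'.
Proof.
move=> sh; elim: sh v' => {u v z} [|a u v z _ IH|a u v z _ IH] v'.
- by move/size0nil=> -> _; exists [::]; first exact: ShuffleNil.
- move=> sv vv'; have [z' sh zz'] := IH _ sv vv'.
  by exists (a :: z'); [apply: ShuffleLeft | rewrite lexi_cons lexx].
case: v' => // b v' [sv]; rewrite lexi_cons => /andP[ab /implyP h].
have [ba|ba] := boolP (b <= a)%O.
  have [z' sh zz'] := IH _ sv (h ba).
  by exists (b :: z'); [apply: ShuffleRight | rewrite lexi_cons ab zz' implybT].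
exists (b :: (u ++ v')); first exact/ShuffleRight/shuffle_of_cat.
by rewrite lexi_cons ab (negbTE ba).
Qed.

(** The factors of [s] exceed [a :: s], which bounds every word of [X]. *)
Lemma lyndon_decr_split_head (a : A) s Z X :
  lyndon_decr ((a :: s) :: X) -> lyndon_decr Z -> flatten Z = s ->
  lyndon_decr (Z ++ X).
Proof.
move=> dlX dZ ZE; have [ll dX lX] := lyndon_decr_cons dlX; split=> [|x].
  rewrite (sorted_pairwise word_ge_trans) pairwise_cat.
  rewrite -!(sorted_pairwise word_ge_trans) (proj1 dZ) (proj1 dX) !andbT.
  apply/allrelP => z x zZ /lX xl; apply: (le_trans xl).
  exact/ltW/(lyndon_suffix_factor_gt ll dZ).
by rewrite mem_cat => /orP[]; [case: dZ => _; apply | case: dX => _; apply].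
Qed.

(** Removing the first letter of a factor [a :: s] breaks it into the Lyndon factors of [s].
    Allowing arbitrary lists on both sides lets the induction hypothesis apply to the result. *)
Lemma shuffle_of_le_wsort u v z X Y : shuffle_of u v z ->
  lyndon_decr X -> lyndon_decr Y -> flatten X = u -> flatten Y = v ->
  z <=l flatten (wsort (X ++ Y)).
Proof.
move=> sh; elim: sh X Y => {u v z} [|a u v z _ IH|a u v z _ IH] X Y.
- by move=> *; apply: lexi0s.
- case: X => [//|[|b s] X] dlX dY //=; first by case: (lyndon_decr_cons dlX) => -[].
  move=> [ba sE] YE; rewrite {b}ba in dlX *.
  have [Z dZ ZE] := lyndon_factor s.
  apply: (le_trans _ (lexi_cons_flatten_wsort_factor dlX dY dZ ZE)).
  rewrite lexi_cons lexx /=; apply: IH => //.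
    exact: lyndon_decr_split_head dlX dZ ZE.
  by rewrite flatten_cat ZE.
move=> dX; case: Y => [//|[|b s] Y] dlY //=; first by case: (lyndon_decr_cons dlY) => -[].
move=> XE [ba sE]; rewrite {b}ba in dlY *.
have [Z dZ ZE] := lyndon_factor s.
(* Sorting ignores the order of concatenation, so this is the previous case with [X] and [Y]
   exchanged. *)
rewrite (@perm_wsort _ (((a :: s) :: Y) ++ X)) 1?perm_catC //.
apply: (le_trans _ (lexi_cons_flatten_wsort_factor dlY dX dZ ZE)).
rewrite lexi_cons lexx /= (@perm_wsort _ (X ++ (Z ++ Y))) 1?perm_catC //.
apply: IH => //; first exact: lyndon_decr_split_head dlY dZ ZE.
by rewrite flatten_cat ZE.
Qed.

Lemma qsh_prod_words_lower br X z : lyndon_decr X -> z \in qsh_prod_words br X ->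
  (size z < size (flatten X))%N
  \/ perm_eq z (flatten X) /\ z <=l flatten X.
Proof.
elim: X z => [|x X IH] z; first by rewrite inE => _ /eqP->; right.
move=> dxX /flatten_mapP[y yX zxy].
have [lx dX _] := lyndon_decr_cons dxX.
have dx : lyndon_decr [:: x] by split=> // t; rewrite inE => /eqP->.
rewrite /= size_cat; case: (qsh_words_size_shuffle zxy) => [lt|sh].
  left; apply: (leq_trans lt); rewrite leq_add2l.
  by case: (IH _ dX yX) => [/ltnW|[/perm_size->]].
case: (IH _ dX yX) => [lt|[pyX yleX]].
  by left; rewrite (perm_size (shuffle_of_perm sh)) size_cat ltn_add2l.
right; split.
  by rewrite (perm_trans (shuffle_of_perm sh)) // perm_cat2l.
(* The word [y] is first raised to [flatten X], of the same length, so that the bound applies to the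
   factorizations [[:: x]] and [X]. *)
have [z' sh' zz'] := shuffle_of_le sh (esym (perm_size pyX)) yleX.
apply: (le_trans zz'); have := shuffle_of_le_wsort sh' dx dX (cats0 x) erefl.
by rewrite wsort_id //; case: dxX.
Qed.

End LyndonWords.

(** * Monoid algebras and linear extension from the basis *)

Lemma malgUM (k : nzRingType) (K : monomType) (u v : K) :
  << u >> * << v >> = << mmul u v >> :> {malg k[K]}.
Proof. by rewrite malgM_def fgmulUU mulr1. Qed.

Section LinearExtension.
Context {k : nzRingType} {K : choiceType}.
Local Notation kK := {malg k[K]}.

Lemma malg_sum_scale (p : kK) : p = \sum_(m <- msupp p) p@_m *: << m >>.
Proof.
rewrite {1}[p]monalgE; apply: eq_bigr => m _; apply/malgP => m'.
by rewrite mcoeffZ !mcoeffU mulr_natr.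
Qed.

Context {V : lmodType k}.

Definition lin_ext (h : K -> V) (p : kK) : V :=
  \sum_(m <- msupp p) p@_m *: h m.

Lemma lin_extEw (h : K -> V) (D : {fset K}) (p : kK) : (msupp p `<=` D)%fset ->
  lin_ext h p = \sum_(m <- D) p@_m *: h m.
Proof.
move=> sD; rewrite /lin_ext (big_fset_incl _ sD) //= => m _ mp.
by rewrite mcoeff_outdom // scale0r.
Qed.

Lemma lin_ext_is_linear h : linear (lin_ext h).
Proof.
move=> c p q.
have sD : (msupp (c *: p + q) `<=` msupp p `|` msupp q)%fset.
  apply: fsubset_trans (msuppD_le _ _) _; apply: fsetSU; exact: msuppZ_le.
rewrite (lin_extEw _ sD) (lin_extEw _ (fsubsetUl (msupp p) (msupp q))).
rewrite (lin_extEw _ (fsubsetUr (msupp p) (msupp q))) scaler_sumr -big_split /=.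
by apply: eq_bigr => m _; rewrite mcoeffD mcoeffZ scalerDl scalerA.
Qed.

HB.instance Definition _ h :=
  GRing.isLinear.Build k kK V *:%R (lin_ext h) (lin_ext_is_linear h).

Lemma lin_extU h m : lin_ext h << m >> = h m.
Proof.
by rewrite /lin_ext msuppU oner_eq0 big_seq_fset1 mcoeffUU scale1r.
Qed.

(** Plain functions with proofs of linearity are taken, so that multilinear identities can be
    checked on words one variable at a time. *)
Lemma lin_ext_unique (f g : kK -> V) : linear f -> linear g ->
  (forall m, f << m >> = g << m >>) -> f =1 g.
Proof.
move=> lf lg fg p.
pose F : {linear kK -> V} := HB.pack f (GRing.isLinear.Build _ _ _ _ f lf).
pose G : {linear kK -> V} := HB.pack g (GRing.isLinear.Build _ _ _ _ g lg).
rewrite -[f]/(F : _ -> _) -[g]/(G : _ -> _) (malg_sum_scale p) !linear_sum.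
by apply: eq_bigr => m _; rewrite !linearZ /= fg.
Qed.

End LinearExtension.

Lemma linear_add (k : nzRingType) (U V : lmodType k) (f g : U -> V) :
  linear f -> linear g -> linear (fun x => f x + g x).
Proof. by move=> lf lg c x y; rewrite lf lg scalerDr addrACA. Qed.

Lemma linear_comp (k : nzRingType) (U V W : lmodType k) (g : V -> W) (f : U -> V) :
  linear g -> linear f -> linear (fun x => g (f x)).
Proof. by move=> lg lf c x y; rewrite lf lg. Qed.

(** * Commutativity and associativity of the quasi-shuffle product *)

(** Both sides are expanded by the product rule and matched term by term. The last seven hypotheses
    are associativity with a nonempty subset of the three leading letters removed. *)
Lemma quasi_shuffle_rule_assoc (V : zmodType) (T : Type) (b : T -> T -> T)
    (L : T -> V -> V) (m : V -> V -> V) :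
  associative b -> (forall x, {morph L x : p q / p + q}) ->
  (forall q, {morph m^~ q : p p' / p + p'}) ->
  (forall p, {morph m p : q q' / q + q'}) ->
  (forall x y p q, m (L x p) (L y q) =
     L x (m p (L y q)) + L y (m (L x p) q) + L (b x y) (m p q)) ->
  forall x y z u v w,
  m u (m (L y v) (L z w)) = m (m u (L y v)) (L z w) ->
  m u (m (L y v) w) = m (m u (L y v)) w ->
  m (L x u) (m v (L z w)) = m (m (L x u) v) (L z w) ->
  m (L x u) (m v w) = m (m (L x u) v) w ->
  m u (m v (L z w)) = m (m u v) (L z w) ->
  m u (m v w) = m (m u v) w ->
  m (L x u) (m (L y v) w) = m (m (L x u) (L y v)) w ->
  m (L x u) (m (L y v) (L z w)) = m (m (L x u) (L y v)) (L z w).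
Proof.
move=> bA LD mDl mDr mL x y z u v w E1 E2 E3 E4 E5 E6 E7.
(* One [L x] term of the right-hand side accounts for three terms of the left; [F2] is the converse
   for [L z]. *)
have F1 : L x (m (m u (L y v)) (L z w)) =
    L x (m u (L y (m v (L z w)))) + L x (m u (L z (m (L y v) w)))
    + L x (m u (L (b y z) (m v w))).
  by rewrite -E1 mL !mDr !LD.
have F2 : L z (m (L x u) (m (L y v) w)) =
    L z (m (L x (m u (L y v))) w) + L z (m (L y (m (L x u) v)) w)
    + L z (m (L (b x y) (m u v)) w).
  by rewrite E7 mL !mDl !LD.
rewrite (mL y z v w) !mDr !mL !mDl !mL F1 -bA F2 E2 E3 E4 E5 E6.
by rewrite [LHS](AC (3*(1*3*1)*3) ((1*4*9*5*8)*(2*6*10)*(3*7*11))).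
Qed.

Section QuasiShuffleAlgebra.
Context {k : fieldType} {A : choiceType}.
Context {br : option A -> option A -> option A}.
Local Notation kA := {malg k[{fmonom A}]}.
Local Notation qsh := (@qshuffle k A br).
Local Notation letter := (@letter k A).
Local Notation wd := (fun s => << word_of s >> : kA).
Implicit Types (p q r : kA) (s t : seq A) (x y : option A).

Lemma qshuffle_lin_ext p q :
  qsh p q = lin_ext (fun u : {fmonom A} =>
              lin_ext (fun v : {fmonom A} => qsh_word k br u v) q) p.
Proof.
apply: eq_bigr => u _; rewrite scaler_sumr; apply: eq_bigr => v _.
by rewrite scalerA.
Qed.

Lemma qshuffle_linearl q : linear (qsh^~ q).
Proof. by move=> c p p'; rewrite !qshuffle_lin_ext linearP. Qed.

Lemma qshuffle_linear p : linear (qsh p).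
Proof.
move=> c q q'; rewrite !qshuffle_lin_ext /lin_ext scaler_sumr -big_split /=.
apply: eq_bigr => u _; rewrite -!/(lin_ext _ _) linearP scalerDr !scalerA.
by rewrite mulrC.
Qed.

Lemma qshuffleDl q : {morph qsh^~ q : p p' / p + p'}.
Proof. by move=> p p'; have := qshuffle_linearl q 1 p p'; rewrite !scale1r. Qed.

Lemma qshuffleDr p : {morph qsh p : q q' / q + q'}.
Proof. by move=> q q'; have := qshuffle_linear p 1 q q'; rewrite !scale1r. Qed.

Lemma qshuffle0q q : qsh 0 q = 0.
Proof. by rewrite qshuffle_lin_ext linear0. Qed.

Lemma qshuffleq0 p : qsh p 0 = 0.
Proof. by apply: (@addrI _ (qsh p 0)); rewrite -qshuffleDr !addr0. Qed.

Lemma qshuffle1q : left_id 1 qsh.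
Proof.
move=> q; apply: (lin_ext_unique (g := id)) q; first exact: qshuffle_linear.
- by [].
- exact: qshuffle1w.
Qed.

Lemma qshuffleq1 : right_id 1 qsh.
Proof.
move=> p; apply: (lin_ext_unique (f := qsh^~ 1) (g := id)) p.
- exact: qshuffle_linearl.
- by [].
- exact: qshufflew1.
Qed.

Lemma letter_None : letter None = 0.
Proof. by []. Qed.

Lemma letter_mulU (a : A) (w : {fmonom A}) :
  letter (Some a) * << w >> = << mmul (fmu a) w >>.
Proof. exact: malgUM. Qed.

Lemma letter_mulZr x c p : letter x * (c *: p) = c *: (letter x * p).
Proof.
case: x => [a|] /=; last by rewrite !mul0r scaler0.
have E q : << fmu a >> * q = lin_ext (fun w => << mmul (fmu a) w >>) q :> kA.
  rewrite malgM_def fgmulUg; apply: eq_bigr => w _; apply/malgP => w'.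
  by rewrite mcoeffZ !mcoeffU mul1r mulr_natr.
by rewrite !E linearZ.
Qed.

Lemma letter_mul_linear x : linear (fun p => letter x * p).
Proof. by move=> c p q; rewrite mulrDr letter_mulZr. Qed.

Hypothesis brC : forall x y, br x y = br y x.
Hypothesis brA : forall x y z, br (br x y) z = br x (br y z).
Hypothesis br0 : forall x, br x None = None.

(** The recursion extends from words to polynomials by bilinearity, and from letters to [None];
    associativity applies it to brackets, which may vanish. *)
Lemma qshuffle_letter x y p q :
  qsh (letter x * p) (letter y * q) =
    letter x * qsh p (letter y * q) + letter y * qsh (letter x * p) q
    + letter (br x y) * qsh p q.
Proof.
case: x => [a|]; last first.
  by rewrite (brC None) br0 letter_None !mul0r !qshuffle0q mulr0 !addr0.
case: y => [b|]; last first.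
  by rewrite br0 letter_None !mul0r !qshuffleq0 mulr0 !addr0.
pose F p q := letter (Some a) * qsh p (letter (Some b) * q)
  + letter (Some b) * qsh (letter (Some a) * p) q
  + letter (br (Some a) (Some b)) * qsh p q.
rewrite -/(F p q).
have LL := letter_mul_linear.
have ql := qshuffle_linearl; have qr := qshuffle_linear.
apply: (lin_ext_unique (f := fun p => qsh (letter (Some a) * p) _) (g := F^~ q)) p.
- exact: linear_comp (ql _) (LL (Some a)).
- apply: linear_add (linear_add (linear_comp (LL _) (ql _))
    (linear_comp (LL _) _)) (linear_comp (LL _) (ql _)).
  exact: linear_comp (ql _) (LL (Some a)).
move=> u.
apply: (lin_ext_unique (f := fun q => qsh _ (letter (Some b) * q)) (g := F << u >>)) q.
- exact: linear_comp (qr _) (LL (Some b)).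
- apply: linear_add (linear_add (linear_comp (LL _) _)
    (linear_comp (LL _) (qr _))) (linear_comp (LL _) (qr _)).
  exact: linear_comp (qr _) (LL (Some b)).
move=> v; rewrite /F !letter_mulU; exact: qshuffle_cons.
Qed.

Lemma wd_cons (a : A) s : wd (a :: s) = letter (Some a) * wd s.
Proof. by rewrite letter_mulU; congr << _ >>; apply/val_inj; rewrite /= fmM fmU. Qed.

Lemma wd0 : wd [::] = 1.
Proof. by congr << _ >>; apply/val_inj; rewrite /= fm1. Qed.

Lemma word_ofK (u : {fmonom A}) : word_of u = u.
Proof. by case: u. Qed.

Lemma qsh_word_cons (a b : A) s t : qsh_word k br (a :: s) (b :: t) =
  letter (Some a) * qsh_word k br s (b :: t)
  + letter (Some b) * qsh_word k br (a :: s) t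
  + letter (br (Some a) (Some b)) * qsh_word k br s t.
Proof. exact: erefl. Qed.

Lemma qshuffleC : commutative qsh.
Proof.
have Cw s t : qsh_word k br s t = qsh_word k br t s.
  elim: s t => [|a s IHs] t; first by case: t.
  elim: t => [|b t IHt]; first exact: erefl.
  rewrite !qsh_word_cons (brC (Some b)) -(IHs t) -(IHs (b :: t)) -IHt.
  by rewrite [X in X + _ = _]addrC.
move=> p q; apply: (lin_ext_unique (f := qsh^~ q) (g := qsh q)) p.
- exact: qshuffle_linearl.
- exact: qshuffle_linear.
move=> u; apply: (lin_ext_unique (f := qsh << u >>) (g := qsh^~ << u >>)) q.
- exact: qshuffle_linear.
- exact: qshuffle_linearl.
by move=> v; rewrite !qshuffle_words.
Qed.

(** The nested inductions on [s], [t] and [r] supply the seven instances required by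
    [quasi_shuffle_rule_assoc]. *)
Lemma qshuffle_wordsA s t (r : seq A) :
  qsh (wd s) (qsh (wd t) (wd r)) = qsh (qsh (wd s) (wd t)) (wd r).
Proof.
elim: s t r => [|a s IHs] t r; first by rewrite wd0 !qshuffle1q.
elim: t r => [|b t IHt] r; first by rewrite wd0 qshuffle1q qshuffleq1.
elim: r => [|c r IHr]; first by rewrite wd0 !qshuffleq1.
have E1 := IHs (b :: t) (c :: r); have E2 := IHs (b :: t) r.
have E3 := IHt (c :: r); have E4 := IHt r; have E5 := IHs t (c :: r).
have E6 := IHs t r; have E7 := IHr.
rewrite !wd_cons in E1 E2 E3 E4 E5 E6 E7 *.
apply: (quasi_shuffle_rule_assoc (b := br) (L := fun x p => letter x * p)
  (m := qsh) _ _ _ _ _ E1 E2 E3 E4 E5 E6 E7).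
- by move=> x y z; rewrite brA.
- by move=> x p q; apply: mulrDr.
- exact: qshuffleDl.
- exact: qshuffleDr.
- exact: qshuffle_letter.
Qed.

Lemma qshuffleA : associative qsh.
Proof.
have ql := qshuffle_linearl; have qr := qshuffle_linear.
move=> p q r.
apply: (lin_ext_unique (f := fun p => qsh p _) (g := fun p => qsh (qsh p q) r)) p.
- exact: ql.
- exact: linear_comp (ql r) (ql q).
move=> u.
apply: (lin_ext_unique (f := fun q => qsh _ (qsh q r))
  (g := fun q => qsh (qsh << u >> q) r)) q.
- exact: linear_comp (qr _) (ql r).
- exact: linear_comp (ql r) (qr _).
move=> v; apply: (lin_ext_unique (f := fun r => qsh _ (qsh _ r)) (g := qsh _)) r.
- exact: linear_comp (qr _) (qr _).
- exact: qr.
move=> w; rewrite -(word_ofK u) -(word_ofK v) -(word_ofK w).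
exact: qshuffle_wordsA.
Qed.


Lemma perm_qshuffle_prod (X Y : seq (seq A)) : perm_eq X Y ->
  \big[qsh/1]_(x <- X) wd x = \big[qsh/1]_(x <- Y) wd x.
Proof.
(* The monoid structure is packed locally, as its laws depend on the hypotheses on [br]. *)
pose M : Monoid.com_law 1 :=
  HB.pack qsh (Monoid.isComLaw.Build kA 1 qsh qshuffleA qshuffleC qshuffle1q).
exact: (perm_big (op := M)).
Qed.

Lemma qshuffle_prod_cat (X Y : seq (seq A)) :
  \big[qsh/1]_(x <- X ++ Y) wd x =
  qsh (\big[qsh/1]_(x <- X) wd x) (\big[qsh/1]_(x <- Y) wd x).
Proof.
pose M : Monoid.com_law 1 :=
  HB.pack qsh (Monoid.isComLaw.Build kA 1 qsh qshuffleA qshuffleC qshuffle1q).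
by rewrite (@big_cat _ _ M).
Qed.

Lemma qsh_wordE s t : qsh_word k br s t = \sum_(z <- qsh_words br s t) wd z.
Proof.
elim: s t => [|a s IHs] t; first by case: t => [|b t]; rewrite big_seq1.
elim: t => [|b t IHt]; first by rewrite big_seq1.
have mapE (c : A) Z : \sum_(z <- map (cons c) Z) wd z
    = letter (Some c) * \sum_(z <- Z) wd z.
  by rewrite big_map mulr_sumr; apply: eq_bigr => z _; rewrite wd_cons.
have catE (Y Z : seq (seq A)) : \sum_(z <- Y ++ Z) wd z
    = \sum_(z <- Y) wd z + \sum_(z <- Z) wd z by rewrite big_cat.
have -> : qsh_words br (a :: s) (b :: t) =
    map (cons a) (qsh_words br s (b :: t)) ++ map (cons b) (qsh_words br (a :: s) t)
    ++ (if br (Some a) (Some b) is Some c then map (cons c) (qsh_words br s t)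
        else [::]) by [].
rewrite qsh_word_cons (IHs (b :: t)) (IHs t) IHt !catE !mapE -addrA.
congr (_ + (_ + _)).
case: (br _ _) => [c|]; first by rewrite mapE.
by rewrite big_nil letter_None mul0r.
Qed.

Lemma qshuffle_prodE (X : seq (seq A)) :
  \big[qsh/1]_(x <- X) wd x = \sum_(z <- qsh_prod_words br X) wd z.
Proof.
elim: X => [|x X IH]; first by rewrite big_nil big_seq1 wd0.
rewrite big_cons IH /= big_flatten big_map /=.
elim: (qsh_prod_words br X) => [|z Z IHZ].
  by rewrite !big_nil qshuffleq0.
by rewrite !big_cons qshuffleDr IHZ qshuffle_words qsh_wordE.
Qed.

Lemma mcoeff_word_sum (Z : seq (seq A)) z :
  (\sum_(y <- Z) wd y)@_(word_of z) = (count_mem z Z)%:R.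
Proof.
elim: Z => [|y Z IH]; first by rewrite big_nil mcoeff0.
by rewrite big_cons mcoeffD IH mcoeffU1 /= natrD.
Qed.

End QuasiShuffleAlgebra.

(** * Commutative monomials as lists up to permutation *)

Section MonomialFactors.
Context {T : choiceType}.
Implicit Types (m : {cmonom T}) (s : seq T).

Definition cmonom_seq m : seq T := flatten [seq nseq (m x) x | x <- finsupp m].

Lemma count_cmonom_seq m x : count_mem x (cmonom_seq m) = m x.
Proof.
rewrite /cmonom_seq count_flatten -map_comp sumnE big_map /=.
have E y : count_mem x (nseq (m y) y) = ((y == x) * m y)%N by rewrite count_nseq.
under eq_bigr => y _ do rewrite E.
have [xm|xm] := boolP (x \in finsupp m).
  rewrite (big_fsetD1 x) //= eqxx mul1n big_seq big1 ?addn0 // => y.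
  by rewrite in_fsetD1 => /andP[/negbTE-> _].
rewrite big_seq big1 => [|y ym]; first by apply/esym/eqP; rewrite cmE_eq0.
by case: eqP => // yx; rewrite yx (negbTE xm) in ym.
Qed.

Lemma cmonom_seq_inj m m' : perm_eq (cmonom_seq m) (cmonom_seq m') -> m = m'.
Proof.
by move/permP=> mm'; apply/eqP/cmP => x; rewrite -!count_cmonom_seq.
Qed.

Lemma cmonom_seqP m s : (forall x, m x = count_mem x s) -> perm_eq (cmonom_seq m) s.
Proof. by move=> ms; apply/allP => x _ /=; rewrite count_cmonom_seq ms. Qed.

Lemma perm_cmonom_seqM m m' :
  perm_eq (cmonom_seq (mmul m m')) (cmonom_seq m ++ cmonom_seq m').
Proof. by apply: cmonom_seqP => x; rewrite cmM count_cat !count_cmonom_seq. Qed.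

Lemma cmonom_seqU x : cmonom_seq (ucm x) = [:: x].
Proof. by apply: perm_small_eq => //; apply: cmonom_seqP => y; rewrite cmU /= addn0. Qed.

Lemma cmonom_seq1 : cmonom_seq (@mone {cmonom T}) = [::].
Proof. by apply/perm_nilP; apply: cmonom_seqP => x; rewrite cm1. Qed.

Lemma cmonom_seq_surj s : exists m, perm_eq (cmonom_seq m) s.
Proof.
elim: s => [|x s [m ms]]; first by exists mone; rewrite cmonom_seq1.
exists (mmul (ucm x) m); apply: (perm_trans (perm_cmonom_seqM _ _)).
by rewrite cmonom_seqU perm_cons.
Qed.

End MonomialFactors.

(** This selects a leading monomial in the support of a polynomial. *)
Lemma seq_max_exists (T : eqType) (r : rel T) (s : seq T) x0 :
  total r -> transitive r -> x0 \in s ->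
  exists2 m, m \in s & forall x, x \in s -> r x m.
Proof.
move=> rt rr; elim: s x0 => // x [|y s] IH _ _.
  by exists x => [|z]; rewrite ?mem_head // inE => /eqP->; case/orP: (rt x x).
have [m ms mP] := IH y (mem_head y s); have [xm|xm] := boolP (r x m).
  by exists m => [|z]; rewrite inE ?ms ?orbT // => /orP[/eqP->|/mP].
exists x => [|z]; first exact: mem_head.
have mx : r m x by have := rt x m; rewrite (negbTE xm).
rewrite inE => /orP[/eqP->|/mP zm]; last exact: rr zm mx.
by case/orP: (rt x x).
Qed.

(** * The bijection between monomials in Lyndon words and words *)

Section LyndonMonomials.
Context {d : Order.disp_t} {A : orderType d}.
Local Notation LW := {w : {fmonom A} | lyndon w}.
Local Notation "x <=l y" := (@Order.le _ (seqlexi A) x y) (at level 70).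
Local Notation "x <l y" := (@Order.lt _ (seqlexi A) x y) (at level 70).

Lemma lyndon_wordP (w : {fmonom A}) : reflect (lyndon_word w) (lyndon w).
Proof.
have fm0 (u : {fmonom A}) : (u <> mone) <-> ((u : seq A) != [::]).
  by rewrite -fm1 -fmP; split=> /eqP.
apply: (iffP (lyndonP w)) => -[w0 lw].
  split=> [|u v u0 v0 wE]; first exact/fm0.
  by apply: (lw (word_of u) (word_of v)); [apply/fm0|apply/fm0|apply/val_inj; rewrite /= fmM].
split=> [|u v /fm0 u0 /fm0 v0 wE]; first exact/fm0.
by apply: lw u0 v0 _; rewrite wE fmM.
Qed.

(** Nonincreasing order makes this list the Lyndon factorization of its concatenation. *)
Definition lyndon_factors (m : {cmonom LW}) : seq (seq A) :=
  sort word_ge [seq val (val x) : seq A | x <- cmonom_seq m].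

Lemma perm_lyndon_factors m :
  perm_eq (lyndon_factors m) [seq val (val x) : seq A | x <- cmonom_seq m].
Proof. by rewrite /lyndon_factors perm_sort. Qed.

Lemma lyndon_factors_decr m : lyndon_decr (lyndon_factors m).
Proof.
split=> [|x]; first exact: wsort_sorted.
by rewrite mem_sort => /mapP[y _ ->]; apply/lyndon_wordP; case: y.
Qed.

(** This is the leading word of the quasi-shuffle monomial attached to [m]. *)
Definition lyndon_flatten (m : {cmonom LW}) : seq A := flatten (lyndon_factors m).

Lemma lyndon_flatten_inj : injective lyndon_flatten.
Proof.
move=> m m' E; apply: cmonom_seq_inj.
have /lyndon_decr_inj := E => /(_ (lyndon_factors_decr _) (lyndon_factors_decr _)) E'.
have : perm_eq [seq val (val x) : seq A | x <- cmonom_seq m]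
               [seq val (val x) : seq A | x <- cmonom_seq m'].
  by rewrite -(permPl (perm_lyndon_factors m)) E' perm_lyndon_factors.
by move/perm_map_inj; apply=> x y /val_inj/val_inj.
Qed.

Lemma lyndon_flatten_surj w : exists m, lyndon_flatten m = w.
Proof.
have [X dX XE] := lyndon_factor w.
have [s sE] : exists s : seq LW, [seq val (val x) : seq A | x <- s] = X.
  case: dX => _; elim: (X) => [|x Y IH] lX; first by exists [::].
  have [s sE] : exists s : seq LW, [seq val (val x) : seq A | x <- s] = Y.
    by apply: IH => y yY; apply: lX; rewrite inE yY orbT.
  have lx : lyndon (word_of x) by apply/lyndon_wordP/lX/mem_head.
  by exists (exist _ (word_of x) lx :: s); rewrite /= sE.
have [m ms] := cmonom_seq_surj s; exists m.
rewrite /lyndon_flatten /lyndon_factors (@perm_wsort _ _ _ X); last first.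
  by rewrite -sE perm_map.
by rewrite wsort_id //; case: dX.
Qed.

End LyndonMonomials.

(** * Triangularity and bijectivity of the evaluation at Lyndon words *)

Lemma count_lt (T : eqType) (a b : pred T) (s : seq T) x :
  subpred a b -> x \in s -> b x -> ~~ a x -> (count a s < count b s)%N.
Proof.
move=> ab xs bx nax; elim: s xs => //= y s IH; rewrite inE => /orP[/eqP<-|/IH lt].
  by rewrite bx (negbTE nax) add0n add1n ltnS sub_count.
by rewrite -addnS leq_add //; case ay: (a y) => //; rewrite (ab y ay).
Qed.

Lemma big_seq_split_eq (k : nzRingType) (V : lmodType k) (T : eqType)
    (f : T -> V) (w : T) (Z : seq T) :
  \sum_(z <- Z) f z =
    (count_mem w Z)%:R *: f w + \sum_(z <- [seq z <- Z | z != w]) f z.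
Proof.
rewrite (bigID (pred1 w)) /= big_filter; congr (_ + _).
rewrite (eq_bigr (fun=> f w)) => [|z /eqP-> //].
by rewrite big_const_seq iter_addr addr0 scaler_nat.
Qed.

Section LyndonPolynomials.
Context {k : fieldType} {d : Order.disp_t} {A : orderType d}.
Context {br : option A -> option A -> option A}.
Local Notation kA := {malg k[{fmonom A}]}.
Local Notation LW := {w : {fmonom A} | lyndon w}.
Local Notation kX := {malg k[{cmonom LW}]}.
Local Notation qsh := (@qshuffle k A br).
Local Notation wd := (fun s => << word_of s >> : kA).
Local Notation "x <=l y" := (@Order.le _ (seqlexi A) x y) (at level 70).
Local Notation "x <l y" := (@Order.lt _ (seqlexi A) x y) (at level 70).

Hypothesis brC : forall x y, br x y = br y x.
Hypothesis brA : forall x y z, br (br x y) z = br x (br y z).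
Hypothesis br0 : forall x, br x None = None.
Hypothesis char0 : [pchar k] =i pred0.

(** The product is taken along the sorted factors, the form to which the bound on [qsh_prod_words]
    applies. *)
Definition lyndon_monomial (m : {cmonom LW}) : kA :=
  \big[qsh/1]_(x <- lyndon_factors m) wd x.

Definition lyndon_eval : kX -> kA := lin_ext lyndon_monomial.

HB.instance Definition _ := GRing.Linear.on lyndon_eval.

Lemma lyndon_monomialE m :
  lyndon_monomial m = \big[qsh/1]_(x <- cmonom_seq m) << val x >>.
Proof.
rewrite /lyndon_monomial (perm_qshuffle_prod brC brA br0 (perm_lyndon_factors m)).
by rewrite big_map; apply: eq_bigr => x _; rewrite word_ofK.
Qed.

Lemma lyndon_monomialM m m' :
  lyndon_monomial (mmul m m') = qsh (lyndon_monomial m) (lyndon_monomial m').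
Proof.
rewrite /lyndon_monomial -(qshuffle_prod_cat brC brA br0).
apply: (perm_qshuffle_prod brC brA br0).
apply: (perm_trans (perm_lyndon_factors _)).
apply: (perm_trans (perm_map _ (perm_cmonom_seqM m m'))).
by rewrite map_cat perm_cat // perm_sym perm_lyndon_factors.
Qed.

Lemma lyndon_evalU m : lyndon_eval << m >> = lyndon_monomial m.
Proof. exact: lin_extU. Qed.

Lemma lyndon_eval_ucm x : lyndon_eval << ucm x >> = << val x >>.
Proof.
by rewrite lyndon_evalU lyndon_monomialE cmonom_seqU big_cons big_nil qshuffleq1.
Qed.

Lemma lyndon_eval1 : lyndon_eval 1 = 1.
Proof. by rewrite lyndon_evalU lyndon_monomialE cmonom_seq1 big_nil. Qed.

Lemma lyndon_evalM p q : lyndon_eval (p * q) = qsh (lyndon_eval p) (lyndon_eval q).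
Proof.
have le : linear lyndon_eval by move=> c x y; rewrite linearP.
have ql := @qshuffle_linearl k A br; have qr := @qshuffle_linear k A br.
apply: (lin_ext_unique (f := fun p => lyndon_eval (p * q))
  (g := fun p => qsh (lyndon_eval p) (lyndon_eval q))) p.
- by apply: (linear_comp le) => c x y; rewrite mulrDl scalerAl.
- exact: linear_comp (ql _) le.
move=> m; apply: (lin_ext_unique (f := fun q => lyndon_eval (<< m >> * q))
  (g := fun q => qsh _ (lyndon_eval q))) q.
- by apply: (linear_comp le) => c x y; rewrite mulrDr scalerAr.
- exact: linear_comp (qr _) le.
move=> m'.
rewrite (_ : << m >> * << m' >> = << mmul m m' >>); last exact: malgUM.
rewrite [LHS]lyndon_evalU [X in qsh X _]lyndon_evalU [X in qsh _ X]lyndon_evalU.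
exact: lyndon_monomialM.
Qed.

Lemma mcoeff_lyndon_monomial m w : (lyndon_monomial m)@_(word_of w) =
  (count_mem w (qsh_prod_words br (lyndon_factors m)))%:R.
Proof. by rewrite /lyndon_monomial qshuffle_prodE mcoeff_word_sum. Qed.

(** The coefficient is a positive count, and characteristic 0 keeps it nonzero in [k]. *)
Lemma lyndon_monomial_lead m :
  (lyndon_monomial m)@_(word_of (lyndon_flatten m)) != 0.
Proof.
have /pcharf0P nat_eq0 := char0.
rewrite mcoeff_lyndon_monomial nat_eq0 -lt0n -has_count has_pred1.
exact: flatten_in_qsh_prod_words.
Qed.

(** Let [m0] be the monomial of [p] with the greatest leading word. No other monomial of [p]
    contributes to that word, so its coefficient in the image is nonzero. *)
Lemma lyndon_eval_eq0 p : lyndon_eval p = 0 -> p = 0.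
Proof.
apply: contra_eq => p0.
(* Leading words are compared by length first, then lexicographically. *)
pose r m m' := (size (lyndon_flatten m) < size (lyndon_flatten m'))%N
  || (size (lyndon_flatten m) == size (lyndon_flatten m'))
     && (lyndon_flatten m <=l lyndon_flatten m').
have rt : total r.
  move=> m m'; rewrite /r; case: ltngtP => //= _; exact: le_total.
have rr : transitive r.
  move=> m2 m1 m3; rewrite /r => /orP[lt12|/andP[/eqP-> le12]].
    by case/orP=> [lt23|/andP[/eqP<- _]]; rewrite ?(ltn_trans lt12 lt23) ?lt12.
  by case/orP=> [->//|/andP[-> le23]]; rewrite (le_trans le12 le23) orbT.
have /fset0Pn[m1 m1p] : msupp p != fset0%fset by rewrite msupp_eq0.
have [m0 m0p m0max] := seq_max_exists rt rr m1p.
have : (lyndon_eval p)@_(word_of (lyndon_flatten m0)) != 0; last first.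
  by apply: contraNneq => ->; rewrite mcoeff0.
rewrite /lyndon_eval /lin_ext raddf_sum /= (big_fsetD1 m0) //= big_seq big1 => [|m].
  by rewrite addr0 mcoeffZ mulf_neq0 ?lyndon_monomial_lead // mcoeff_neq0.
rewrite in_fsetD1 => /andP[mm0 mp].
rewrite mcoeffZ mcoeff_lyndon_monomial.
set Z := qsh_prod_words _ _; set w0 := lyndon_flatten m0.
(* If [w0] occurs in the product for [m], the leading word of [m] is either longer, against
   maximality, or of the same length and at least [w0], hence equal to it. *)
have [/count_memPn-> |] := boolP (w0 \notin Z); first by rewrite mulr0.
rewrite negbK => /(qsh_prod_words_lower (lyndon_factors_decr m)).
rewrite -/(lyndon_flatten m) => -[lt|[pm le]].
  have := m0max m mp; rewrite /r ltnNge (ltnW lt) /=.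
  by rewrite gtn_eqF.
have := m0max m mp; rewrite /r (perm_size pm) ltnn eqxx /= => le'.
case/eqP: mm0; apply: lyndon_flatten_inj.
by apply: (@le_anti _ (seqlexi A)); rewrite le le'.
Qed.

Lemma lyndon_eval_surj_sum (Z : seq (seq A)) :
  (forall z, z \in Z -> exists p, lyndon_eval p = wd z) ->
  exists p, lyndon_eval p = \sum_(z <- Z) wd z.
Proof.
elim: Z => [|z Z IH] h; first by exists 0; rewrite linear0 big_nil.
have [p pE] := h z (mem_head _ _).
have [q qE] : exists q, lyndon_eval q = \sum_(z <- Z) wd z.
  by apply: IH => y yZ; apply: h; rewrite inE yZ orbT.
by exists (p + q); rewrite big_cons -pE -qE linearD.
Qed.

(** The triangular system is solved by induction on the length and, within a length, on the rank of
    the word among its rearrangements. *)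
Lemma lyndon_eval_surj_word w : exists p, lyndon_eval p = wd w.
Proof.
have [n] := ubnP (size w); elim: n w => // n IHn w; rewrite ltnS => wn.
(* The lexicographic order on words of a given length need not be well founded, but a word has
   finitely many rearrangements. *)
pose below u := count (fun y => y <l u) (permutations u).
have [c] := ubnP (below w); elim: c w wn => // c IHc w wn; rewrite ltnS => wc.
have [m mE] := lyndon_flatten_surj w.
pose Z := qsh_prod_words br (lyndon_factors m).
have [p pE] : exists p, lyndon_eval p = \sum_(z <- [seq z <- Z | z != w]) wd z.
  apply: lyndon_eval_surj_sum => z; rewrite mem_filter => /andP[zw zZ].
  have := qsh_prod_words_lower (lyndon_factors_decr m) zZ.
  rewrite -/(lyndon_flatten m) mE => -[lt|[pzw zlew]].
    by apply: IHn; apply: leq_trans lt wn.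
  have zltw : z <l w by rewrite lt_neqAle zw.
  apply: IHc; first by rewrite (perm_size pzw).
  apply: leq_trans wc; rewrite /below.
  (* Both ranks are counted in the same set; [z] itself is counted for [w] but not for [z]. *)
  have pp : perm_eq (permutations z) (permutations w).
    apply: uniq_perm; rewrite ?permutations_uniq // => y.
    by rewrite !mem_permutations (permPr pzw).
  rewrite (permP pp); apply: (count_lt (x := z)) => //; last by rewrite ltxx.
    by move=> y yz; apply: lt_trans zltw.
  by rewrite mem_permutations.
have n0 : (count_mem w Z)%:R != 0 :> k.
  by have := lyndon_monomial_lead m; rewrite mE mcoeff_lyndon_monomial.
(* The image of [<< m >>] is a nonzero multiple of [w] plus the image of [p]; this witness solves
   for [w]. *)
exists ((count_mem w Z)%:R^-1 *: (<< m >> - p)).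
rewrite linearZ linearB /= lyndon_evalU pE.
apply: (canLR (scalerK n0)).
rewrite /lyndon_monomial qshuffle_prodE -/Z.
by rewrite (big_seq_split_eq wd w Z) addrK.
Qed.

Lemma lyndon_eval_bijective : bijective lyndon_eval.
Proof.
have inj : injective lyndon_eval.
  move=> p q E; apply/eqP; rewrite -subr_eq0; apply/eqP/lyndon_eval_eq0.
  by rewrite linearB /= E subrr.
have surj (w : {fmonom A}) : exists p, lyndon_eval p == << w >>.
  by have [p pE] := lyndon_eval_surj_word w; exists p; rewrite pE word_ofK.
(* Chosen preimages of the words extend linearly to a right inverse, which injectivity makes
   two-sided. *)
pose h := lin_ext (fun w => xchoose (surj w)).
have hK : cancel h lyndon_eval.
  apply: (lin_ext_unique (f := fun p => lyndon_eval (h p)) (g := id)).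
  - by move=> c x y; rewrite /h !linearP.
  - by [].
  by move=> w; rewrite /h lin_extU; apply/eqP/(xchooseP (surj w)).
by exists h => // p; apply: inj; rewrite hK.
Qed.

Lemma qshuffle_polynomial_algebra_on_lyndon :
  polynomial_algebra_on qsh 1 (fun w : LW => << val w >>).
Proof.
split.
  split; [exact: qshuffleA | exact: qshuffleC | exact: qshuffle1q |].
  exact: qshuffle_linear.
exists lyndon_eval; split.
- exact: lyndon_eval_bijective.
- exact: lyndon_eval1.
- exact: lyndon_evalM.
- exact: lyndon_eval_ucm.
Qed.

End LyndonPolynomials.

Unset Implicit Arguments.

Theorem theorem2p6 (R : realType) (S : pred R[i]) (k : subFieldType S)
    (d : Order.disp_t) (A : orderType d) (deg : A -> nat)
    (br : option A -> option A -> option A)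
    (hdeg : locally_finite_grading deg) (hbr : qs_bracket deg br) :
  polynomial_algebra_on (qshuffle (k := k) br) 1
    (fun w : {w : {fmonom A} | lyndon w} => << val w >>).
Proof.
case: hbr => br0 brC brA _.
apply: qshuffle_polynomial_algebra_on_lyndon => // x.
(* The embedding of [k] into [R[i]] preserves the characteristic, which is 0. *)
by rewrite -(fmorph_pchar (val : {rmorphism k -> R[i]})) pchar_num.
Qed.
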